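(* Let $P$ be a model of Atomic Core Mereology, i.e. an atomic poset. Then the inclusion map $\alpha\colon P\to H(P)$ is a fusion-completion of $P$, and for any other dense fusion-completion $e\colon P\to M$ of $P$ there is an injective fusion-preserving and order-preserving map $g\colon H(P)\to M$ such that $g\circ\alpha=e$.
   Context: In a poset $P$, $x\circ y$ (overlap) means that there is $z\in P$ with $z\le x$ and $z\le y$. An atom of a poset is an element $x$ such that $y\le x$ implies $y=x$; a poset is atomic if every element has an atom below it (or equal to it); $\operatorname{Atoms}(P)$ is the set of atoms of $P$. For $x\in P$ let $\mathsf{O}(x)=\{y\in P\mid x\circ y\}$, and for $A\subseteq P$ let $\mathsf{O}(A)=\bigcup\{\mathsf{O}(x)\mid x\in A\}$. For $\varnothing\ne A\subseteq P$, an element $x\in P$ is a fusion of $A$ if for every $y\in P$: $y\circ x$ if and only if $y\circ z$ for some $z\in A$. A poset is fusion-complete if every nonempty subset has a fusion. A map $f$ of posets is order-preserving if $x\le y$ implies $f(x)\le f(y)$, and an order-embedding if $x\le y\iff f(x)\le f(y)$. A map $f\colon P\to M$ is: $\circ$-reflecting if $f(x)\circ f(y)$ implies $x\circ y$; fusion-preserving if $f(x)$ is a fusion of $f(A)$ in $M$ whenever $x\in P$ is a fusion of $A\subseteq P$; fusion-dense if for every $m\in M$ there is $A\subseteq P$ such that $m$ is a fusion of $f(A)$ in $M$; dense if for every $m\in M$ there is $p\in P$ with $f(p)\le m$. A fusion-completion of $P$ is a fusion-complete poset $M$ together with a $\circ$-reflecting, fusion-preserving and fusion-dense order-embedding $e\colon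 P\to M$; it is dense if $e$ is dense. $H(P)$ is the set $P\cup\{f_{\mathsf{O}(A)}\mid \varnothing\neq A\subseteq P\text{ has no fusion in }P\}$, where the $f_{\mathsf{O}(A)}$ are new formal elements not in $P$, indexed by the sets $\mathsf{O}(A)$ (so $f_{\mathsf{O}(A)}=f_{\mathsf{O}(B)}$ iff $\mathsf{O}(A)=\mathsf{O}(B)$). Its order $\sqsubseteq$ is: on $P$ the given order; each $f_{\mathsf{O}(A)}\sqsubseteq f_{\mathsf{O}(A)}$; for $x\in P$, $x\sqsubseteq f_{\mathsf{O}(A)}$ iff $x\in\operatorname{Atoms}(P)$ and $\mathsf{O}(x)\subseteq\mathsf{O}(A)$; distinct new elements are incomparable; and no new element is below an element of $P$. *)

(* Defs.v *)
From HB Require Import structures.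
From mathcomp Require Import all_boot all_order.
From mathcomp Require Import boolp classical_sets.

Set Implicit Arguments.
Unset Strict Implicit.
Unset Printing Implicit Defensive.

Import Order.TTheory.

Local Open Scope classical_set_scope.
Local Open Scope order_scope.

Section Mereology.
Context {d : Order.disp_t} {P : porderType d}.
Implicit Types (x y z : P) (A : set P).

Definition overlap x y : Prop := exists z, z <= x /\ z <= y.

Definition atom x : Prop := forall y, y <= x -> y = x.

Definition overlaps_of x : set P := [set y | overlap x y].

Definition overlaps_of_set A : set P := \bigcup_(x in A) overlaps_of x.

Definition is_fusion A x : Prop :=
  A !=set0 /\ forall y, overlap y x <-> exists2 z, A z & overlap y z.

End Mereology.

Definition atomic {d : Order.disp_t} (P : porderType d) : Prop :=
  forall x : P, exists2 a : P, atom a & a <= x.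

Definition fusion_complete {d : Order.disp_t} (P : porderType d) : Prop :=
  forall A : set P, A !=set0 -> exists x : P, is_fusion A x.

Section Maps.
Context {d d' : Order.disp_t} {P : porderType d} {M : porderType d'}.
Implicit Types f e : P -> M.

Definition order_preserving f : Prop := {homo f : x y / x <= y}.

Definition order_embedding f : Prop := {mono f : x y / x <= y}.

Definition overlap_reflecting f : Prop :=
  forall x y : P, overlap (f x) (f y) -> overlap x y.

Definition fusion_preserving f : Prop :=
  forall (A : set P) (x : P), is_fusion A x -> is_fusion (f @` A) (f x).

Definition fusion_dense f : Prop :=
  forall m : M, exists A : set P, is_fusion (f @` A) m.

Definition dense_map f : Prop := forall m : M, exists p : P, f p <= m.

Definition fusion_completion e : Prop :=
  [/\ fusion_complete M, order_embedding e, overlap_reflecting e,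
      fusion_preserving e & fusion_dense e].

Definition dense_fusion_completion e : Prop :=
  fusion_completion e /\ dense_map e.

End Maps.

Section HCompletion.
Context {d : Order.disp_t} (P : porderType d).

(* The index set of the new elements: the sets O(A) for A a nonempty subset
   without fusion. Indexing by the set O(A) rather than by A identifies the
   new elements of A and B exactly when O(A) = O(B). *)
Definition unfused : set (set P) :=
  [set overlaps_of_set A
     | A in [set A : set P | A !=set0 /\ ~ exists x : P, is_fusion A x]].

Inductive Hcompl : Type := Hincl of P | Hnew of set_type unfused.

HB.instance Definition _ := gen_eqMixin Hcompl.
HB.instance Definition _ := gen_choiceMixin Hcompl.

Definition Hle (u v : Hcompl) : bool :=
  match u, v with
  | Hincl x, Hincl y => x <= y
  | Hincl x, Hnew s => `[< atom x /\ overlaps_of x `<=` val s >]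
  | Hnew s, Hnew t => s == t
  | Hnew _, Hincl _ => false
  end.

Lemma Hle_refl : reflexive Hle.
Proof. by case=> [x|S] /=; [exact: lexx | exact: eqxx]. Qed.

Lemma Hle_anti : antisymmetric Hle.
Proof.
case=> [x|S] [y|T] //=; first by move/le_anti ->.
- by rewrite andbF.
- by case/andP => /eqP ->.
Qed.

Lemma Hle_trans : transitive Hle.
Proof.
case=> [y|T] [x|S] [z|U] //=; first exact: le_trans.
- by move=> xy /asboolP[ay yU]; apply/asboolP; rewrite (ay _ xy).
- by move=> xT /eqP <-.
- by move/eqP ->.
Qed.

HB.instance Definition _ :=
  Order.Le_isPOrder.Build d Hcompl Hle_refl Hle_anti Hle_trans.

End HCompletion.

Arguments Hincl {d P}.
Arguments Hnew {d P}.

(* Main.v *)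
Require Import Defs.
From mathcomp Require Import all_boot all_order.
From mathcomp Require Import boolp classical_sets.

(** In an atomic poset overlap is sharing an atom, so an element matters for
    fusions only through the set of atoms below it: [m] is a fusion of a
    nonempty set [B] exactly when the atoms below [m] are those below some
    member of [B] ([is_fusion_traceP]). All the posets involved have the same
    atoms: those of [P] remain atoms in [Hcompl P], where they lie below every
    element, and a dense fusion-completion [e : P -> M] sends the atoms of [P]
    to atoms of [M] that again lie below every element. Each element of [P],
    [Hcompl P] or [M] thus has a trace, a set of atoms of [P], and any map that
    preserves traces preserves fusions ([trace_fusion_preserving]).

    The trace of a new element with index [O(A)] is the set of atoms below
    some member of [A]. Hence every nonempty set of atoms is the trace of an
    element of [Hcompl P]: of its fusion in [P] if there is one, and of a new
    element otherwise. This is fusion-completeness. Conversely, the trace of a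
    new element is that of no other element ([trace_Hnew_inj]), because it
    determines the index, and because an element of [P] with that trace would
    be a fusion of [A].

    The map [g] is [e] on [P] and sends a new element [u] to a fusion in [M] of
    the image under [e] of the trace of [u]. It preserves traces, which gives
    preservation of fusions, injectivity and monotonicity. *)

Set Implicit Arguments.
Unset Strict Implicit.
Unset Printing Implicit Defensive.

Import Order.TTheory.

Local Open Scope classical_set_scope.
Local Open Scope order_scope.

Section Trace.
Context {d d' : Order.disp_t} {P : porderType d} {M : porderType d'}.
Implicit Types (f : P -> M) (m n : M) (B : set M).

(** The atoms of [P] give, through [f], atoms of [M], with at least one of them
    below each element of [M]. *)
Definition atom_base f : Prop :=
  (forall a, atom a -> atom (f a)) /\ forall m, exists2 a, atom a & f a <= m.

(** The atoms of [P] whose image under [f] lies below [m]. *)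
Definition trace f m : set P := [set a | atom a /\ f a <= m].

Lemma atom_overlap m n : atom m -> overlap m n -> m <= n.
Proof. by move=> am [z [zm zn]]; rewrite -(am _ zm). Qed.

Lemma overlap_traceP f m n : atom_base f ->
  overlap m n <-> trace f m `&` trace f n !=set0.
Proof.
move=> [_ fb]; split=> [[z [zm zn]]|[a [[_ am] [_ an]]]]; last by exists (f a).
have [a aa az] := fb z.
by exists a; split; split=> //; exact: le_trans az _.
Qed.

Lemma is_fusion_traceP f B m : atom_base f ->
  is_fusion B m <-> B !=set0 /\ trace f m = \bigcup_(z in B) trace f z.
Proof.
move=> fb; split=> [[B0 Bm]|[B0 Bm]]; split=> //.
  apply/seteqP; split=> [a [aa am]|a [z Bz [aa az]]].
    have : overlap (f a) m by exists (f a).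
    case/Bm => z Bz faz; exists z => //; split=> //.
    by apply: atom_overlap faz; exact: fb.1.
  split=> //; apply: atom_overlap; first exact: fb.1.
  by apply/Bm; exists z => //; exists (f a).
move=> y; rewrite (overlap_traceP y m fb) Bm.
split=> [[a [ya [z Bz za]]]|[z Bz]].
  by exists z => //; apply/(overlap_traceP _ _ fb); exists a.
by rewrite (overlap_traceP y z fb) => -[a [ya za]]; exists a; split=> //; exists z.
Qed.

Lemma trace_neq0 f m : atom_base f -> trace f m !=set0.
Proof. by move=> [_ fb]; have [a aa am] := fb m; exists a. Qed.

Lemma is_fusion_trace f m : atom_base f -> is_fusion (f @` trace f m) m.
Proof.
move=> fb; apply/(is_fusion_traceP _ _ fb); split.
  exact/image_nonempty/trace_neq0.
rewrite bigcup_image; apply/seteqP; split=> [a am|a [b [_ bm] [aa ab]]].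
  by exists a => //; split=> //; case: am.
by split=> //; exact: le_trans ab bm.
Qed.

End Trace.

Lemma trace_fusion_preserving (d d1 d2 : Order.disp_t) (P : porderType d)
    (Q : porderType d1) (M : porderType d2) (f1 : P -> Q) (f2 : P -> M)
    (g : Q -> M) :
  atom_base f1 -> atom_base f2 -> (forall q, trace f2 (g q) = trace f1 q) ->
  fusion_preserving g.
Proof.
move=> b1 b2 gE B x /(is_fusion_traceP _ _ b1)[B0 Bx].
apply/(is_fusion_traceP _ _ b2); split; first exact/image_nonempty.
by rewrite gE Bx bigcup_image; apply: eq_bigcupr => z _; rewrite gE.
Qed.

Section Embedding.
Context {d d' : Order.disp_t} {P : porderType d} {M : porderType d'}.

Lemma atom_base_id : atomic P -> atom_base (@id P).
Proof. by move=> hP; split. Qed.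

Lemma atom_base_dense (e : P -> M) :
  atomic P -> order_embedding e -> dense_map e -> atom_base e.
Proof.
move=> hP emb dns; split=> [a aa n na|m].
  have [q qn] := dns n.
  have qa : q <= a by rewrite -emb (le_trans qn na).
  by apply/le_anti; rewrite na -(aa _ qa) qn.
have [q qm] := dns m; have [a aa aq] := hP q.
by exists a => //; apply: le_trans _ qm; rewrite emb.
Qed.

Lemma trace_embedding (e : P -> M) x :
  order_embedding e -> trace e (e x) = trace id x.
Proof. by move=> emb; apply/seteqP; split=> a [aa]; rewrite /trace /= emb. Qed.

Lemma overlaps_of_set_traceE (A : set P) : atomic P ->
  overlaps_of_set A =
  [set y | trace id y `&` \bigcup_(z in A) trace id z !=set0].
Proof.
move=> hP; have b := atom_base_id hP.
apply/seteqP; split=> y /=.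
  by move=> [z Az /(overlap_traceP _ _ b)[a [za ya]]]; exists a; split=> //; exists z.
by move=> [a [ya [z Az za]]]; exists z => //; apply/(overlap_traceP _ _ b); exists a.
Qed.

End Embedding.

Section HcomplTrace.
Context {d : Order.disp_t} (P : porderType d) (hP : atomic P).
Implicit Types (A : set P) (u v : Hcompl P).

Lemma Hincl_embedding : order_embedding (Hincl : P -> Hcompl P).
Proof. by []. Qed.

Lemma trace_Hnew A (s : set_type (@unfused d P)) : val s = overlaps_of_set A ->
  trace Hincl (Hnew s) = \bigcup_(z in A) trace id z.
Proof.
move=> sA; apply/seteqP; split=> a.
  case=> aa /asboolP[_]; rewrite sA => /(_ a)[]; first by exists a.
  by move=> z Az za; exists z => //; split=> //; apply: (atom_overlap aa);
    case: za => w [wz wa]; exists w.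
case=> z Az [aa az]; split=> //; apply/asboolP; split=> // y [w [wa wy]].
rewrite sA; exists z => //; exists w; split=> //.
exact: le_trans wa az.
Qed.

(** Density of [Hincl] holds because a new element comes from a nonempty set,
    hence has an atom below it. *)
Lemma Hincl_dense : dense_map (Hincl : P -> Hcompl P).
Proof.
case=> [x|s]; first by exists x.
have [A [[z Az] _] As] := set_valP s.
have [a aa az] := hP z.
have : trace Hincl (Hnew s) a by rewrite (trace_Hnew (esym As)); exists z.
by case=> _ ?; exists a.
Qed.

Lemma atom_base_Hincl : atom_base (Hincl : P -> Hcompl P).
Proof. exact: atom_base_dense hP Hincl_embedding Hincl_dense. Qed.

Lemma trace_Hnew_inj s v : trace Hincl (Hnew s) = trace Hincl v -> Hnew s = v.
Proof.
have [A [A0 nA] As] := set_valP s; rewrite (trace_Hnew (esym As)).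
case: v => [x|t].
  rewrite (trace_embedding _ Hincl_embedding) => xA; case: nA.
  by exists x; apply/(is_fusion_traceP _ _ (atom_base_id hP)).
have [B _ Bt] := set_valP t; rewrite (trace_Hnew (esym Bt)) => AB.
congr Hnew; apply: val_inj.
by rewrite -As -Bt !overlaps_of_set_traceE // AB.
Qed.

Lemma Hcompl_fusion_complete : fusion_complete (Hcompl P).
Proof.
move=> B B0; pose S := \bigcup_(u in B) trace Hincl u.
have SE : \bigcup_(a in S) trace id a = S.
  apply/seteqP; split=> [b [a [u Bu [_ au]] [ab ba]]|a Sa].
    by exists u => //; split=> //; apply: le_trans _ au.
  by exists a => //; split=> //; case: Sa => u _ [].
have S0 : S !=set0.
  have [u Bu] := B0; have [a ua] := trace_neq0 u atom_base_Hincl.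
  by exists a, u.
suff [m mS] : exists m : Hcompl P, trace Hincl m = S.
  by exists m; apply/(is_fusion_traceP _ _ atom_base_Hincl).
have [[x /(is_fusion_traceP _ _ (atom_base_id hP))[_ xS]]|nS] :=
    pselect (exists x, is_fusion S x).
  by exists (Hincl x); rewrite (trace_embedding _ Hincl_embedding) xS SE.
have uS : unfused (overlaps_of_set S) by exists S.
exists (Hnew (SigSub (mem_set uS))).
by rewrite (@trace_Hnew S) // SE.
Qed.

Lemma Hincl_fusion_completion : fusion_completion (Hincl : P -> Hcompl P).
Proof.
have bH := atom_base_Hincl; have bP := atom_base_id hP.
have tr x := trace_embedding x Hincl_embedding.
split.
- exact: Hcompl_fusion_complete.
- exact: Hincl_embedding.
- by move=> x y /(overlap_traceP _ _ bH); rewrite !tr => /(overlap_traceP _ _ bP).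
- exact: trace_fusion_preserving bP bH tr.
- by move=> m; exists (trace Hincl m); exact: is_fusion_trace.
Qed.

End HcomplTrace.

Theorem corollary7p7 (d : Order.disp_t) (P : porderType d) (hP : atomic P) :
  fusion_completion (Hincl : P -> Hcompl P) /\
  forall (d' : Order.disp_t) (M : porderType d') (e : P -> M),
    dense_fusion_completion e ->
    exists g : Hcompl P -> M,
      [/\ injective g, fusion_preserving g, order_preserving g
        & g \o Hincl = e].
Proof.
split; first exact: Hincl_fusion_completion.
move=> d' M e [[Mc emb _ _ _] dns].
have bH := atom_base_Hincl hP; have bM := atom_base_dense hP emb dns.
have /choice[h hE] : forall s, exists m,
    is_fusion (e @` trace Hincl (Hnew s : Hcompl P)) m.
  by move=> s; apply: Mc; exact/image_nonempty/trace_neq0.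
pose g (u : Hcompl P) := match u with Hincl x => e x | Hnew s => h s end.
have gE u : trace e (g u) = trace Hincl u.
  case: u => [x|s] /=.
    by rewrite (trace_embedding _ emb) (trace_embedding _ (@Hincl_embedding _ P)).
  have /(is_fusion_traceP _ _ bM)[_ ->] := hE s.
  rewrite bigcup_image; apply/seteqP; split=> [b [a as_ [ab]]|a as_].
    by rewrite emb => /(as_.1) ->.
  by exists a => //; split=> //; case: as_.
exists g; split=> //.
- move=> u v uv; have tuv : trace Hincl u = trace Hincl v by rewrite -!gE uv.
  case: u v => [x|s] [y|t] in uv tuv *.
  + by congr Hincl; apply/le_anti; rewrite -!emb [e x]uv lexx.
  + exact/esym/(trace_Hnew_inj hP)/esym.
  + exact: (trace_Hnew_inj hP).
  + exact: (trace_Hnew_inj hP).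
- exact: trace_fusion_preserving bH bM gE.
- case=> [x|s] [y|t] //= st.
  + by rewrite emb.
  + have : trace Hincl (Hnew t) x by split=> //; case/asboolP: st.
    by rewrite -gE => -[].
  + by rewrite (eqP st).
Qed.
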